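(* Let $D$ be an integral domain. The semistar operations $b$ and $v$ coincide on $\boldsymbol{F}(D)$ (the set of nonzero fractional ideals of $D$) if and only if $D$ is an h-local Prüfer domain such that the maximal ideals are finitely generated or, equivalently, if and only if the (semi)star operations $d$ and $v$ coincide on $\boldsymbol{F}(D)$ and $D$ is integrally closed.
   Context: Let $D$ be an integral domain with quotient field $K$. An overring of $D$ is a ring $T$ with $D\subseteq T\subseteq K$; a valuation overring is an overring which is a valuation domain. For each nonzero $D$-submodule $E$ of $K$: $E^d:=E$; $E^b:=\bigcap\{EV \mid V \text{ valuation overring of } D\}$; $E^v:=(D:(D:E))$, where $(D:E):=\{x\in K\mid xE\subseteq D\}$. A domain is h-local if each nonzero ideal is contained in at most finitely many maximal ideals and each nonzero prime ideal is contained in a unique maximal ideal. *)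

(* Defs.v *)
(* MathComp, with the Prop-valued sets of mathcomp-classical. *)
From mathcomp Require Import all_boot all_algebra.
From mathcomp Require Import classical_sets cardinality.

Set Implicit Arguments.
Unset Strict Implicit.
Unset Printing Implicit Defensive.

Import GRing.Theory.
Local Open Scope classical_set_scope.
Local Open Scope ring_scope.

Notation "x %:F" := (@FracField.tofrac _ x) : ring_scope.

Definition has_nonzero (V : zmodType) (A : set V) : Prop :=
  exists2 x, A x & x != 0.

(** Ideals of D. *)

Definition ideal (D : idomainType) (I : set D) : Prop :=
  GRing.submod_closed ([in I] : {pred D^o}).

(* [idealr_closed] includes properness: 1 \notin P. *)
Definition prime_ideal (D : idomainType) (P : set D) : Prop :=
  idealr_closed [in P] /\ prime_idealr_closed [in P].

Definition maximal_ideal (D : idomainType) (M : set D) : Prop :=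
  idealr_closed [in M] /\
  forall J : set D, idealr_closed [in J] -> M `<=` J -> J = M.

Definition finitely_generated (D : idomainType) (I : set D) : Prop :=
  exists (n : nat) (a : 'I_n -> D),
    I = [set x | exists c : 'I_n -> D, x = \sum_(i < n) c i * a i].

(** D-submodules of the quotient field K = {fraction D}. *)

(* D viewed inside K *)
Definition base (D : idomainType) : set {fraction D} :=
  range (@FracField.tofrac D).
Arguments base : clear implicits.

Definition submodule (D : idomainType) (E : set {fraction D}) : Prop :=
  [/\ E 0,
      forall x y, E x -> E y -> E (x + y)
    & forall (a : D) x, E x -> E (a%:F * x)].

(* the product EF : finite sums of products ef *)
Definition prodset (D : idomainType) (E F : set {fraction D}) :
    set {fraction D} :=
  [set x | exists (n : nat) (e f : 'I_n -> {fraction D}),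
     [/\ forall i, E (e i), forall i, F (f i) & x = \sum_(i < n) e i * f i]].

(* (D : E) *)
Definition colon (D : idomainType) (E : set {fraction D}) :
    set {fraction D} :=
  [set x | forall e, E e -> base D (x * e)].

(* membership in F(D) *)
Definition fractional_ideal (D : idomainType) (E : set {fraction D}) : Prop :=
  [/\ submodule E, has_nonzero E
    & exists2 d : D, d != 0 & forall x, E x -> base D (d%:F * x)].

Definition invertible (D : idomainType) (E : set {fraction D}) : Prop :=
  exists2 F : set {fraction D}, submodule F & prodset E F = base D.

Definition overring (D : idomainType) (T : set {fraction D}) : Prop :=
  base D `<=` T /\ GRing.subring_closed [in T].

(* Every overring of D has quotient field K, so being a valuation domain is
   tested on the elements of K. *)
Definition valuation_overring (D : idomainType) (V : set {fraction D}) : Prop :=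
  overring V /\ forall x, x != 0 -> V x \/ V x^-1.

(** Semistar operations; only their values on nonzero submodules matter. *)

Definition op_d (D : idomainType) (E : set {fraction D}) : set {fraction D} :=
  E.

Definition op_b (D : idomainType) (E : set {fraction D}) : set {fraction D} :=
  \bigcap_(V in @valuation_overring D) prodset E V.

Definition op_v (D : idomainType) (E : set {fraction D}) : set {fraction D} :=
  colon (colon E).

Definition coincide_on_fractional (D : idomainType)
    (s t : set {fraction D} -> set {fraction D}) : Prop :=
  forall E, fractional_ideal E -> s E = t E.

(** Classes of integral domains. *)

Definition integrally_closed (D : idomainType) : Prop :=
  forall x : {fraction D}, integralOver (@FracField.tofrac D) x -> base D x.

Definition prufer (D : idomainType) : Prop :=
  forall I : set D, ideal I -> has_nonzero I -> finitely_generated I ->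
    invertible (@FracField.tofrac D @` I).

Definition h_local (D : idomainType) : Prop :=
  (forall I : set D, ideal I -> has_nonzero I ->
     finite_set [set M : set D | maximal_ideal M /\ I `<=` M]) /\
  (forall P : set D, prime_ideal P -> has_nonzero P ->
     exists! M : set D, maximal_ideal M /\ P `<=` M).

(* Main.v *)
Require Import Defs.
From mathcomp Require Import all_boot all_algebra.
From mathcomp Require Import boolp classical_sets cardinality ring.

(** Both [b = v], and [d = v] for integrally closed [D], force [D] to be a Prüfer
    domain. There [b] and [d] agree, so that everything reduces to Heinzer's
    problem: when is each nonzero ideal of a Prüfer domain divisorial?

    Prüfer domains. For a finitely generated ideal [I] with inverse (D : I), an
    [x] with x(D : I) ⊆ (D : I) satisfies xI ⊆ I^v. If [d = v] this makes [x]
    integral over [D] by the determinant trick; if [b = v] it puts [x] in each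
    valuation overring [V], where [IV] is principal, hence in D^b = D^v = D.
    Thus I(D : I) has trivial inverse and its [v]-closure is [D]. It is then [D]
    itself: at once if [d = v], and for [b = v] because a proper ideal survives
    in some valuation overring ([valuation_overring_center], which is
    Chevalley's extension theorem). Conversely the localizations of a Prüfer
    domain at its maximal ideals are valuation overrings, so E^b is contained in
    the intersection of the E D_M, which is [E] ([prufer_op_b]).

    From [d = v] to h-local. For nonzero [a], the fractional ideals D_M ∩ a⁻¹D
    intersect in [D]; by duality their inverses generate [D], while the one
    attached to [M] lies in every other maximal ideal that contains [a]. Hence
    only finitely many maximal ideals contain [a], and some [c] outside [M]
    satisfies c(D_M ∩ a⁻¹D) ⊆ D. In a Prüfer domain such a [c] cannot coexist
    with a nonzero prime lying under [M] and another maximal ideal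
    ([divisorial_prime_maximal]). A nonzero maximal ideal is (D : (1, x)) for
    some [x], which is finitely generated because (1, x) is invertible.

    From h-local to [d = v]. If [M] and [N] are distinct, no nonzero prime lies
    under both, so every nonzero [a] divides a product of an element outside [M]
    by an element outside [N]; multiplying over the finitely many [N] containing
    [a] gives again a [c] outside [M] with c(D_M ∩ a⁻¹D) ⊆ D. This carries the
    easy divisoriality of ideals of the valuation ring D_M, whose maximal ideal
    is principal, down to [D] ([h_local_divisorial]). *)

Set Implicit Arguments.
Unset Strict Implicit.
Unset Printing Implicit Defensive.

Import GRing.Theory.
Local Open Scope classical_set_scope.
Local Open Scope quotient_scope.
Local Open Scope ring_scope.

Section Theory.
Variable D : idomainType.
Local Notation K := {fraction D}.
Implicit Types (I J M N : set D) (E F G V : set K).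

(** * Ideals and fractions *)

Lemma fractionP (x : K) : exists p q : D, q != 0 /\ x = p%:F / q%:F.
Proof.
elim/quotW: x => x; exists (\n_x), (\d_x); split; first exact: denom_ratioP.
suff xE : \pi_K x * (\d_x)%:F = (\n_x)%:F.
  by rewrite -xE mulfK// tofrac_eq0 denom_ratioP.
apply/eqP; rewrite piE FracField.equivfE /FracField.mulf /=.
rewrite !numden_Ratio ?oner_eq0 ?mulf_neq0 ?oner_eq0 ?denom_ratioP //.
by rewrite ?mulr1 mulrC.
Qed.

Lemma idealP I :
  ideal I <-> [/\ I 0, forall x y, I x -> I y -> I (x + y)
                & forall a x, I x -> I (a * x)].
Proof.
split=> [[]|[I0 ID IM]].
  rewrite !in_setE => I0 Il.
  have lin a u v : I u -> I v -> I (a * u + v).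
    by move=> Iu Iv; have := Il a u v; rewrite !in_setE; apply.
  split=> // [x y Ix Iy|a x Ix]; first by rewrite -[x]mul1r; apply: lin.
  by rewrite -[_ * _]addr0; apply: lin.
split; first by rewrite !in_setE.
by move=> a u v; rewrite !in_setE => Iu Iv; apply: ID => //; apply: IM.
Qed.

Lemma proper_idealP I : idealr_closed [in I] <-> ideal I /\ ~ I 1.
Proof.
split=> [[I0 I1 Il]|[[I0 Il] I1]]; last first.
  by split=> //; apply/negP; rewrite !in_setE.
split; first by split=> // a u v; apply: Il.
by move/negP: I1; rewrite !in_setE.
Qed.

Lemma maximal_idealP M : maximal_ideal M <->
  [/\ ideal M, ~ M 1 & forall J, ideal J -> ~ J 1 -> M `<=` J -> J = M].
Proof.
split=> [[/proper_idealP[idM M1] maxM]|[idM M1 maxM]].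
  by split=> // J idJ J1; apply: maxM; apply/proper_idealP.
by split=> [|J /proper_idealP[]]; [apply/proper_idealP|apply: maxM].
Qed.

Lemma maximal_inv M x : maximal_ideal M -> ~ M x ->
  exists a, M (1 - a * x).
Proof.
case/maximal_idealP=> /idealP[M0 MD MM] M1 maxM xM; apply: contrapT => noa.
pose J := [set y | exists a, M (y - a * x)].
suff JM : J = M by apply: xM; rewrite -JM; exists 1; rewrite mul1r subrr.
apply: maxM => [|[a Ma]|y My]; [|by apply: noa; exists a|]; last first.
  by exists 0; rewrite mul0r subr0.
apply/idealP; split; first by exists 0; rewrite mul0r subr0.
  move=> y z [a Ma] [b Mb]; exists (a + b).
  have -> : y + z - (a + b) * x = (y - a * x) + (z - b * x) by ring.
  by apply: MD.
move=> c y [a Ma]; exists (c * a).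
have -> : c * y - c * a * x = c * (y - a * x) by ring.
  by apply: MM.
Qed.

Lemma maximal_prime M x y : maximal_ideal M -> ~ M x -> ~ M y -> ~ M (x * y).
Proof.
move=> maxM xM yM Mxy; apply: yM.
have [/idealP[M0 MD MM] M1 _] := (maximal_idealP M).1 maxM.
have [a Ma] := maximal_inv maxM xM.
have -> : y = y * (1 - a * x) + a * (x * y) by ring.
by apply: MD; apply: MM.
Qed.

Lemma maximal_sub M N : maximal_ideal M -> maximal_ideal N ->
  M `<=` N -> M = N.
Proof.
case/maximal_idealP=> _ _ maxM /maximal_idealP[idN N1 _] MN.
by rewrite (maxM N).
Qed.

Lemma maximal_neq M N : maximal_ideal M -> maximal_ideal N -> M <> N ->
  exists2 x, M x & ~ N x.
Proof.
move=> maxM maxN; apply: contra_notP => noex.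
apply: maximal_sub => // x Mx; apply: contrapT => Nx.
by apply: noex; exists x.
Qed.

Lemma ideal_sub_maximal I : ideal I -> ~ I 1 ->
  exists2 M, maximal_ideal M & I `<=` M.
Proof.
move=> idI I1.
(* The empty set is admitted because Zorn's lemma also asks for the union of
   the empty chain. *)
pose good J := J = set0 \/ [/\ ideal J, ~ J 1 & I `<=` J].
have [F Fgood Ftot|M [gM maxM]] := @Zorn_bigcup D good.
  have [[J [FJ Jne]]|allnil] :=
      pselect (exists J, F J /\ J <> set0); last first.
    left; rewrite -subset0 => x [J FJ Jx]; apply: allnil; exists J.
    by split=> // J0; rewrite J0 in Jx.
  have mem X x : F X -> X x -> [/\ ideal X, ~ X 1 & I `<=` X].
    by move=> FX Xx; case: (Fgood X FX) => // X0; rewrite X0 in Xx.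
  have [x0 Jx0] : exists x, J x by apply/set0P/eqP.
  have [/idealP[J0 JD JM] J1 IJ] := mem _ _ FJ Jx0.
  right; split; last by move=> x Ix; exists J => //; apply: IJ.
    apply/idealP; split; first by exists J.
      move=> x y [X FX Xx] [Y FY Yy].
      have [/idealP[_ XD _] _ _] := mem _ _ FX Xx.
      have [/idealP[_ YD _] _ _] := mem _ _ FY Yy.
      have [XY|YX] := Ftot _ _ FX FY.
        by exists Y => //; apply: YD => //; apply: XY.
      by exists X => //; apply: XD => //; apply: YX.
    move=> a x [X FX Xx]; exists X => //.
    by have [/idealP[_ _ XM] _ _] := mem _ _ FX Xx; apply: XM.
  by case=> X FX X1; have [_ ] := mem _ _ FX X1.
have gI : good I by right; split.
have [idM M1 IM] : [/\ ideal M, ~ M 1 & I `<=` M].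
  case: gM => // M0; case: (maxM I) => //; rewrite M0; split=> //.
  by case/idealP: idI => I0 _ _ /(_ 0 I0).
exists M => //; apply/maximal_idealP; split=> // J idJ J1 MJ.
apply: contrapT => JM; case: (maxM J); last first.
  by right; split=> // x /IM; apply: MJ.
by split=> // JsM; apply: JM; rewrite eqEsubset.
Qed.

(** * Submodules of the quotient field *)

Lemma base_tofrac (a : D) : base D a%:F. Proof. by exists a. Qed.

Lemma base0 : base D 0. Proof. by exists 0; rewrite ?tofrac0. Qed.
Lemma base1 : base D 1. Proof. by exists 1; rewrite ?tofrac1. Qed.

Lemma baseD (x y : K) : base D x -> base D y -> base D (x + y).
Proof. by move=> [a _ <-] [b _ <-]; rewrite -tofracD; apply: base_tofrac. Qed.

Lemma baseB (x y : K) : base D x -> base D y -> base D (x - y).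
Proof. by move=> [a _ <-] [b _ <-]; rewrite -tofracB; apply: base_tofrac. Qed.

Lemma baseM (x y : K) : base D x -> base D y -> base D (x * y).
Proof. by move=> [a _ <-] [b _ <-]; rewrite -tofracM; apply: base_tofrac. Qed.

Lemma base_inj (a : D) (A : set D) : (@FracField.tofrac D @` A) a%:F -> A a.
Proof. by case=> b Ab /eqP; rewrite tofrac_eq => /eqP <-. Qed.

Lemma base_submodule : submodule (base D).
Proof.
split=> [|x y|a x bx]; [exact: base0|exact: baseD|].
by apply: baseM => //; apply: base_tofrac.
Qed.

Lemma submodule_baseM E x y : submodule E -> base D x -> E y -> E (x * y).
Proof. by case=> _ _ EM [a _ <-]; apply: EM. Qed.

Lemma closed_sum E n (f : 'I_n -> K) :
  E 0 -> (forall x y, E x -> E y -> E (x + y)) ->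
  (forall i, E (f i)) -> E (\sum_(i < n) f i).
Proof. by move=> E0 ED Ef; apply: (big_ind E). Qed.

Lemma submodule_sum E n (f : 'I_n -> K) : submodule E ->
  (forall i, E (f i)) -> E (\sum_(i < n) f i).
Proof. by case=> E0 ED _; apply: closed_sum. Qed.

Lemma submodule_image I : ideal I -> submodule (@FracField.tofrac D @` I).
Proof.
case/idealP=> I0 ID IM; split; first by exists 0; rewrite ?tofrac0.
  by move=> _ _ [a Ia <-] [b Ib <-]; exists (a + b); rewrite ?tofracD//; apply: ID.
by move=> a _ [b Ib <-]; exists (a * b); rewrite ?tofracM//; apply: IM.
Qed.

Lemma ideal_preimage E : submodule E -> ideal [set d : D | E d%:F].
Proof.
case=> E0 ED EM; apply/idealP; split=> /=; first by rewrite tofrac0.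
  by move=> x y; rewrite tofracD; apply: ED.
by move=> a x; rewrite tofracM; apply: EM.
Qed.

Lemma submodule_scale E (y : K) : submodule E -> submodule [set x | E (x * y)].
Proof.
case=> E0 ED EM; split=> /=; first by rewrite mul0r.
  by move=> x z Ex Ez; rewrite mulrDl; apply: ED.
by move=> a x Ex; rewrite -mulrA; apply: EM.
Qed.

Lemma ideal_denominators E (x : K) : submodule E -> ideal [set d : D | E (d%:F * x)].
Proof. by move=> /(submodule_scale x)/ideal_preimage. Qed.

Lemma submodule_colon E : submodule (colon E).
Proof.
split=> [e _|x y cx cy e Ee|a x cx e Ee]; first by rewrite mul0r; apply: base0.
  by rewrite mulrDl; apply: baseD; [apply: cx|apply: cy].
by rewrite -mulrA; apply: baseM; [apply: base_tofrac|apply: cx].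
Qed.

Lemma fractional_integral E : submodule E -> has_nonzero E -> E `<=` base D ->
  fractional_ideal E.
Proof.
move=> sE nE Eb; split=> //; exists 1; rewrite ?oner_eq0// => x Ex.
by rewrite tofrac1 mul1r; apply: Eb.
Qed.

Lemma fractional_image I : ideal I -> has_nonzero I ->
  fractional_ideal (@FracField.tofrac D @` I).
Proof.
move=> idI [a Ia a0]; apply: fractional_integral; first exact: submodule_image.
  by exists a%:F; [exists a|rewrite tofrac_eq0].
by move=> _ [b _ <-]; apply: base_tofrac.
Qed.

Lemma fractional_base : fractional_ideal (base D).
Proof.
apply: fractional_integral => //; first exact: base_submodule.
by exists 1; [exact: base1|exact: oner_neq0].
Qed.

Lemma sub_op_v E : E `<=` op_v E.
Proof. by move=> x Ex y cy; rewrite mulrC; apply: cy. Qed.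

Lemma op_v_base : op_v (base D) = base D.
Proof.
rewrite eqEsubset; split; last exact: sub_op_v.
by move=> x /(_ 1); rewrite mulr1; apply=> e be; rewrite mul1r.
Qed.

(** The global-to-local principle: membership in a submodule may be checked
    one maximal ideal at a time, since a proper ideal of denominators would lie
    in some maximal ideal. *)
Lemma submodule_local E (x : K) : submodule E ->
  (forall M, maximal_ideal M -> exists2 s, ~ M s & E (s%:F * x)) -> E x.
Proof.
move=> sE loc; have idA := ideal_denominators x sE.
have [Ex|Ex] := pselect (E (1%:F * x)); first by rewrite tofrac1 mul1r in Ex.
have [M maxM AM] := ideal_sub_maximal idA Ex.
by have [s sM Es] := loc M maxM; case: sM; apply: AM.
Qed.

Lemma overringP V : overring V <->
  [/\ base D `<=` V, forall x y, V x -> V y -> V (x - y)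
    & forall x y, V x -> V y -> V (x * y)].
Proof.
split=> [[bV [_ VB VM]]|[bV VB VM]].
  split=> // x y Vx Vy; first by have := VB x y; rewrite !in_setE; apply.
  by have := VM x y; rewrite !in_setE; apply.
split=> //; split=> [|x y|x y]; rewrite !in_setE.
- by apply: bV; apply: base1.
- exact: VB.
- exact: VM.
Qed.

Lemma overringD V x y : overring V -> V x -> V y -> V (x + y).
Proof.
case/overringP=> bV VB VM Vx Vy; rewrite -[y]opprK; apply: (VB) => //.
by rewrite -sub0r; apply: (VB) => //; apply: bV; apply: base0.
Qed.

Lemma overring_submodule V : overring V -> submodule V.
Proof.
move=> oV; have [bV VB VM] := (overringP V).1 oV.
split=> [|x y|a x]; [by apply: bV; apply: base0|exact: overringD|].
by apply: VM; apply: bV; apply: base_tofrac.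
Qed.

Lemma prodset_mul E F e f : E e -> F f -> prodset E F (e * f).
Proof.
move=> Ee Ff; exists 1%N, (fun=> e), (fun=> f).
by split=> //; rewrite big_ord1.
Qed.

Lemma prodset_sub E F G : G 0 -> (forall x y, G x -> G y -> G (x + y)) ->
  (forall e f, E e -> F f -> G (e * f)) -> prodset E F `<=` G.
Proof.
move=> G0 GD Gm x [n [e [f [Ee Ff ->]]]].
by apply: closed_sum => // i; apply: Gm.
Qed.

Lemma prodset0 E F : prodset E F 0.
Proof. by exists 0%N, (fun=> 0), (fun=> 0); split=> [[]|[]|]; rewrite ?big_ord0. Qed.

Lemma prodsetD E F x y : prodset E F x -> prodset E F y -> prodset E F (x + y).
Proof.
move=> [m [e1 [f1 [Ee1 Ff1 ->]]]] [n [e2 [f2 [Ee2 Ff2 ->]]]].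
pose glue (g1 : 'I_m -> K) (g2 : 'I_n -> K) (i : 'I_(m + n)) :=
  match split i with inl j => g1 j | inr j => g2 j end.
exists (m + n)%N, (glue e1 e2), (glue f1 f2); rewrite /glue; split=> [i|i|].
- by case: split.
- by case: split.
rewrite big_split_ord /=; congr (_ + _); apply: eq_bigr => i _.
  by rewrite (unsplitK (inl i)).
by rewrite (unsplitK (inr i)).
Qed.

Lemma prodset_submodule E F : submodule E -> submodule (prodset E F).
Proof.
case=> _ _ EM; split=> [|x y|a _ [n [e [f [Ee Ff ->]]]]].
- exact: prodset0.
- exact: prodsetD.
exists n, (fun i => a%:F * e i), f; split=> // [i|]; first exact: EM.
by rewrite mulr_sumr; apply: eq_bigr => i _; rewrite mulrA.
Qed.

Lemma sub_op_b E : E `<=` op_b E.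
Proof.
move=> x Ex V [/overringP[bV _ _] _]; rewrite -[x]mulr1.
by apply: prodset_mul => //; apply: bV; apply: base1.
Qed.

(** * Invertibility and localization *)

Definition localization M : set K :=
  [set x | exists2 s, ~ M s & base D (s%:F * x)].

Lemma localization_overring M : maximal_ideal M -> overring (localization M).
Proof.
move=> maxM; have [_ M1 _] := (maximal_idealP M).1 maxM.
apply/overringP; split=> [x bx|x y [s sM bx] [t tM by_]|x y [s sM bx] [t tM by_]].
- by exists 1 => //; rewrite tofrac1 mul1r.
- exists (s * t); first exact: maximal_prime.
  have -> : (s * t)%:F * (x - y) = t%:F * (s%:F * x) - s%:F * (t%:F * y).
    by rewrite tofracM; ring.
  by apply: baseB; apply: baseM => //; apply: base_tofrac.
- exists (s * t); first exact: maximal_prime.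
  have -> : (s * t)%:F * (x * y) = (s%:F * x) * (t%:F * y).
    by rewrite tofracM; ring.
  exact: baseM.
Qed.

Lemma invertible_dual_basis E : invertible E ->
  exists n (e f : 'I_n -> K), [/\ forall i, E (e i),
    forall i y, E y -> base D (y * f i) & 1 = \sum_(i < n) e i * f i].
Proof.
move=> [F _ EF]; have := base1; rewrite -EF => -[n [e [f [Ee Ff s1]]]].
exists n, e, f; split=> // i y Ey; exact: prodset_mul.
Qed.

(** An invertible ideal is locally principal: not every term [e i * f i] of a
    dual basis can lie in [M], and a term outside [M] makes [e i] a generator
    at [M]. *)
Lemma invertible_locally_principal E M : invertible E -> maximal_ideal M ->
  exists e f s, [/\ E e, forall y, E y -> base D (y * f), ~ M s & e * f = s%:F].
Proof.
move=> /invertible_dual_basis[n [e [f [Ee bf s1]]]] maxM.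
have [idM M1 _] := (maximal_idealP M).1 maxM.
apply: contrapT => nog; apply: M1; apply: base_inj; rewrite tofrac1 s1.
apply: submodule_sum => [|i]; first exact: submodule_image.
have [s _ sE] := bf i _ (Ee i); exists s => //; apply: contrapT => sM.
by apply: nog; exists (e i), (f i), s; split=> //; apply: bf.
Qed.

Definition ideal_span n (a : 'I_n -> D) : set D :=
  [set x | exists c : 'I_n -> D, x = \sum_(i < n) c i * a i].

Lemma ideal_span_ideal n (a : 'I_n -> D) : ideal (ideal_span a).
Proof.
apply/idealP; split=> [|_ _ [c ->] [d ->]|b _ [c ->]].
- by exists (fun=> 0); rewrite big1// => i _; rewrite mul0r.
- exists (fun i => c i + d i); rewrite -big_split /=.
  by apply: eq_bigr => i _; rewrite mulrDl.
- exists (fun i => b * c i); rewrite mulr_sumr.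
  by apply: eq_bigr => i _; rewrite mulrA.
Qed.

Lemma ideal_span_gen n (a : 'I_n -> D) i : ideal_span a (a i).
Proof.
exists (fun j => (j == i)%:R); rewrite (bigD1 i)//= eqxx mul1r big1 ?addr0//.
by move=> j /negPf->; rewrite mul0r.
Qed.

Definition span2 (p q : D) : set D := [set x | exists u v, x = u * p + v * q].

Lemma span2E p q : span2 p q = ideal_span (fun i : 'I_2 => if val i == 0%N then p else q).
Proof.
rewrite eqEsubset; split=> [_ [u [v ->]]|_ [c ->]].
  exists (fun i => if val i == 0%N then u else v).
  by rewrite !big_ord_recl big_ord0 /= addr0.
by exists (c ord0), (c (lift ord0 ord0)); rewrite !big_ord_recl big_ord0 /= addr0.
Qed.

Lemma prufer_span2 p q : prufer D -> q != 0 ->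
  invertible (@FracField.tofrac D @` span2 p q).
Proof.
move=> prD q0; apply: prD.
- by rewrite span2E; apply: ideal_span_ideal.
- by exists q => //; exists 0, 1; ring.
- by exists 2%N, (fun i : 'I_2 => if val i == 0%N then p else q); apply: span2E.
Qed.

Lemma prufer_localization_valuation M : prufer D -> maximal_ideal M ->
  valuation_overring (localization M).
Proof.
move=> prD maxM; split=> [|x]; first exact: localization_overring.
have [p [q [q0 xE]]] := fractionP x => _.
have qF0 : q%:F != 0 :> K by rewrite tofrac_eq0.
have [idM _ _] := (maximal_idealP M).1 maxM.
have [_ [f [s [[_ [u [v ->]] <-] bf sM efs]]]] :=
  invertible_locally_principal (prufer_span2 p prD q0) maxM.
have [a _ aE] : base D (p%:F * f).
  by apply: bf; exists p => //; exists 1, 0; ring.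
have [b _ bE] : base D (q%:F * f).
  by apply: bf; exists q => //; exists 0, 1; ring.
have [Mb|Mb] := pselect (M b); last first.
  left; exists b => //; rewrite xE bE.
  have -> : q%:F * f * (p%:F / q%:F) = p%:F * f by field.
  by rewrite -aE; apply: base_tofrac.
have [Ma|Ma] := pselect (M a).
  case: sM; case/idealP: idM => _ MD MM.
  have -> : s = u * a + v * b.
    apply/eqP; rewrite -(tofrac_eq s) -efs !(tofracD, tofracM) aE bE.
    by apply/eqP; ring.
  by apply: MD; apply: MM.
right; exists a => //; rewrite xE aE invf_div.
have [p0|p0] := eqVneq (p%:F : K) 0.
  by rewrite p0 mul0r mul0r; apply: base0.
have -> : p%:F * f * (q%:F / p%:F) = q%:F * f by field.
by rewrite -bE; apply: base_tofrac.
Qed.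

(** [b] is trivial over a Prüfer domain: the localizations at the maximal ideals
    are valuation overrings, and they detect membership in [E]. *)
Lemma prufer_op_b E : prufer D -> submodule E -> op_b E = E.
Proof.
move=> prD sE; rewrite eqEsubset; split; last exact: sub_op_b.
move=> x bx; apply: submodule_local => // M maxM; have [E0 ED EM] := sE.
have [idM M1 _] := (maximal_idealP M).1 maxM.
have := bx _ (prufer_localization_valuation prD maxM).
apply: (prodset_sub (G := [set y | exists2 s, ~ M s & E (s%:F * y)])) =>
  [|y z [s sM Ey] [t tM Ez]|e f Ee [s sM bf]].
- by exists 1; rewrite ?mulr0.
- exists (s * t); first exact: maximal_prime.
  have -> : (s * t)%:F * (y + z) = t%:F * (s%:F * y) + s%:F * (t%:F * z).
    by rewrite tofracM; ring.
  by apply: ED; apply: EM.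
- exists s => //; have -> : s%:F * (e * f) = (s%:F * f) * e by ring.
  exact: submodule_baseM.
Qed.

(** If [x] is outside [V], its inverse is inside, and dividing an integral
    equation of degree [n] by [x ^+ n.-1] expresses [x] by elements of [V]. *)
Lemma integral_valuation_overring (x : K) V : valuation_overring V ->
  integralOver (@FracField.tofrac D) x -> V x.
Proof.
move=> [oV valV] [p monp rootp].
have [V0 VD _] := overring_submodule oV; have [bV VB VM] := (overringP V).1 oV.
have [->|x0] := eqVneq x 0; first by apply: bV; apply: base0.
have [//|Vxi] := valV x x0.
have VX k : V (x^-1 ^+ k).
  elim: k => [|k IHk]; first by rewrite expr0; apply: bV; apply: base1.
  by rewrite exprS; apply: VM.
have := rootp; rewrite /root horner_coef size_map_inj_poly ?tofrac0//; last first.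
  by move=> a b /eqP; rewrite tofrac_eq => /eqP.
have p0 : p != 0 by apply: monic_neq0.
have sp : (0 < size p)%N by rewrite size_poly_gt0.
case: (size p) sp (lead_coefE p) => // n _; rewrite (monicP monp) /= => pn.
rewrite big_ord_recr /= coef_map /= -pn tofrac1 mul1r.
case: n {pn} => [|n]; first by rewrite big_ord0 add0r expr0 oner_eq0.
rewrite addrC addr_eq0 => /eqP xn.
have -> : x = - \sum_(i < n.+1) (map_poly (@FracField.tofrac D) p)`_i * x^-1 ^+ (n - i).
  have xE : x = x ^+ n.+1 * x^-1 ^+ n by rewrite exprS exprVn mulfK// expf_neq0.
  rewrite [LHS]xE xn mulNr mulr_suml; congr (- _); apply: eq_bigr => i _.
  have -> : x^-1 ^+ n = x^-1 ^+ i * x^-1 ^+ (n - i).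
    by rewrite -exprD subnKC// -ltnS.
  by rewrite -!mulrA [x ^+ i * _]mulrA -exprMn mulfV// expr1n mul1r.
rewrite -sub0r; apply: VB => //; apply: closed_sum => // i.
by apply: VM => //; rewrite coef_map; apply: bV; apply: base_tofrac.
Qed.

(** * Existence of valuation overrings *)

Lemma det_congruent V F n (A B : 'M[K]_n) : overring V -> submodule F ->
  (forall x y, V x -> F y -> F (x * y)) ->
  (forall i j, [/\ V (A i j), V (B i j) & F (A i j - B i j)]) ->
  F (\det A - \det B).
Proof.
move=> oV sF VF AB; have [F0 FD _] := sF.
have [V0 VD _] := overring_submodule oV; have [bV VB VM] := (overringP V).1 oV.
have V1 : V 1 by apply: bV; apply: base1.
pose R x y := [/\ V x, V y & F (x - y)].
have RD x1 x2 y1 y2 : R x1 x2 -> R y1 y2 -> R (x1 + y1) (x2 + y2).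
  move=> [Vx1 Vx2 Fx] [Vy1 Vy2 Fy]; split; [exact: VD|exact: VD|].
  have -> : x1 + y1 - (x2 + y2) = (x1 - x2) + (y1 - y2) by ring.
  exact: FD.
have RM x1 x2 y1 y2 : R x1 x2 -> R y1 y2 -> R (x1 * y1) (x2 * y2).
  move=> [Vx1 Vx2 Fx] [Vy1 Vy2 Fy]; split; [exact: VM|exact: VM|].
  have -> : x1 * y1 - x2 * y2 = y1 * (x1 - x2) + x2 * (y1 - y2) by ring.
  by apply: FD; apply: VF.
suff [] : R (\det A) (\det B) by [].
apply: (big_ind2 R) => // [|s _]; first by split=> //; rewrite subrr.
apply: (RM).
  have VN : V (-1) by rewrite -sub0r; apply: VB.
  by split; rewrite ?subrr//; case: (perm.odd_perm s); rewrite ?expr1 ?expr0.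
by apply: (big_ind2 R) => [|//|i _]; [split=> //; rewrite subrr|exact: AB].
Qed.

(** Nakayama's lemma in the form needed here. Since [1 - A] kills [v], its
    determinant vanishes, while modulo [F] it is the determinant of the
    identity. *)
Lemma nakayama V F n (A : 'M[K]_n) (v : 'rV[K]_n) :
  overring V -> submodule F -> F `<=` V ->
  (forall x y, V x -> F y -> F (x * y)) ->
  (forall i j, F (A i j)) -> v != 0 -> v *m A = v -> F 1.
Proof.
move=> oV sF FV VF FA v0 vA; have [F0 _ _] := sF.
have [V0 VD _] := overring_submodule oV; have [bV VB VM] := (overringP V).1 oV.
have V1 : V 1 by apply: bV; apply: base1.
have VN x : V x -> V (- x) by move=> Vx; rewrite -sub0r; apply: VB.
have FN x : F x -> F (- x) by move=> Fx; rewrite -mulN1r; apply: VF => //; apply: VN.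
have det0 : \det (1%:M - A) = 0.
  by apply/eqP/det0P; exists v => //; rewrite mulmxBr mulmx1 vA subrr.
have := @det_congruent V F _ (1%:M - A) 1%:M oV sF VF.
rewrite det0 det1 sub0r => F1; rewrite -[1]opprK; apply/FN/F1 => i j.
have V1ij : V ((1%:M : 'M[K]_n) i j) by rewrite mxE; case: eqP => _.
rewrite [X in V X]mxE [in X in F X]mxE; split=> //.
  by apply: VD => //; rewrite mxE; apply/VN/FV.
by rewrite addrAC subrr add0r mxE; apply: FN.
Qed.

Lemma prodset_mono E F G : F `<=` G -> prodset E F `<=` prodset E G.
Proof.
by move=> FG x [n [e [f [Ee Ff ->]]]]; exists n, e, f; split=> // i; apply: FG.
Qed.

Lemma prodset_scaler E V x y : overring V -> V x -> prodset E V y ->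
  prodset E V (x * y).
Proof.
case/overringP=> _ _ VM Vx [n [e [f [Ee Vf ->]]]].
exists n, e, (fun i => x * f i); split=> // [i|]; first exact: VM.
by rewrite mulr_sumr; apply: eq_bigr => i _; rewrite mulrCA.
Qed.

Lemma prodset_bigcup E (C : set (set K)) x : C !=set0 -> total_on C subset ->
  prodset E (\bigcup_(V in C) V) x -> exists2 V, C V & prodset E V x.
Proof.
move=> [W CW] Ctot; apply: (prodset_sub (G := [set y | exists2 V, C V & prodset E V y])).
- by exists W => //; apply: prodset0.
- move=> y z [U CU Uy] [V CV Vz]; have [UV|VU] := Ctot _ _ CU CV.
    by exists V => //; apply: prodsetD => //; apply: prodset_mono Uy.
  by exists U => //; apply: prodsetD => //; apply: prodset_mono Vz.
- by move=> e f Ee [V CV Vf]; exists V => //; apply: prodset_mul.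
Qed.

Definition adjoin V (x : K) : set K :=
  [set y | exists2 p : {poly K}, forall i, V p`_i & y = p.[x]].

Lemma adjoin_overring V x : overring V -> overring (adjoin V x).
Proof.
move=> oV; have [V0 VD _] := overring_submodule oV; have [bV VB VM] := (overringP V).1 oV.
apply/overringP; split=> [y by_|_ _ [p Vp ->] [q Vq ->]|_ _ [p Vp ->] [q Vq ->]].
- exists y%:P; rewrite ?hornerC// => i; rewrite coefC.
  by case: eqP => // _; apply: bV.
- by exists (p - q); rewrite ?hornerD ?hornerN// => i; rewrite coefB; apply: VB.
- exists (p * q); rewrite ?hornerM// => i; rewrite coefM.
  by apply: closed_sum => // j; apply: VM.
Qed.

Lemma adjoin_sub V x : overring V -> V `<=` adjoin V x.
Proof.
move=> oV y Vy; have [V0 _ _] := overring_submodule oV.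
by exists y%:P; rewrite ?hornerC// => i; rewrite coefC; case: eqP.
Qed.

Lemma adjoin_gen V x : overring V -> adjoin V x x.
Proof.
move=> oV; have [V0 _ _] := overring_submodule oV; have [bV _ _] := (overringP V).1 oV.
exists 'X; rewrite ?hornerX// => i; rewrite coefX.
by case: eqP => _ //; apply: bV; apply: base1.
Qed.

Lemma prodset_adjoin E V x y : submodule E -> prodset E (adjoin V x) y ->
  exists2 q : {poly K}, forall i, prodset E V q`_i & y = q.[x].
Proof.
move=> sE; have [P0 PD _] := prodset_submodule V sE.
apply: (prodset_sub (G := [set y | exists2 q : {poly K}, _ & _])).
- by exists 0 => [i|]; rewrite ?horner0 ?coef0.
- move=> _ _ [p Pp ->] [q Pq ->]; exists (p + q); rewrite ?hornerD// => i.
  by rewrite coefD; apply: PD.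
- move=> e _ Ee [p Vp ->]; exists (e *: p); rewrite ?hornerZ// => i.
  by rewrite coefZ; apply: prodset_mul.
Qed.

(** Writing [1] in both EV[x] and EV[x⁻¹] makes the module spanned over [V] by
    [L] consecutive powers of [x] equal to its product with EV: the first
    relation rewrites the low powers, the second one the high powers.
    Nakayama's lemma then gives [1] in EV. *)
Lemma adjoin_inv E V (x : K) : overring V -> submodule E -> E `<=` V ->
  x != 0 -> prodset E (adjoin V x) 1 -> prodset E (adjoin V x^-1) 1 ->
  prodset E V 1.
Proof.
move=> oV sE EV x0 /(prodset_adjoin sE)[q Fq q1] /(prodset_adjoin sE)[r Fr r1].
have sF := prodset_submodule V sE; have [F0 FD _] := sF.
have [V0 VD _] := overring_submodule oV; have [_ _ VM] := (overringP V).1 oV.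
have FV : prodset E V `<=` V.
  by apply: prodset_sub => // e f Ee Vf; apply: VM => //; apply: EV.
set L := (size r + size q)%N.
have powL (k : 'I_L) : exists P : {poly K},
    [/\ forall i, prodset E V P`_i, (size P <= L)%N & P.[x] = x ^+ k].
  have [kr|rk] := ltnP k (size r).
    exists ('X^k * q); split=> [i||].
    - by rewrite coefXnM; case: ifP.
    - apply: leq_trans (size_polyMleq _ _) _; rewrite size_polyXn addSn /=.
      by rewrite leq_add2r ltnW.
    - by rewrite hornerM hornerXn -q1 mulr1.
  exists (\sum_(j < size r) r`_j *: 'X^(k - j)); split=> [i||].
  - rewrite coef_sum; apply: closed_sum => // j.
    by rewrite coefZ coefXn; case: eqP => _; rewrite ?mulr1 ?mulr0.
  - apply: leq_trans (size_sum _ _ _) _; apply/bigmax_leqP => j _.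
    apply: leq_trans (size_scale_leq _ _) _; rewrite size_polyXn.
    by apply: leq_ltn_trans (leq_subr _ _) (ltn_ord k).
  - rewrite horner_sum -[RHS]mulr1 r1 horner_coef mulr_sumr; apply: eq_bigr => j _.
    rewrite hornerZ hornerXn mulrCA; congr (_ * _).
    have jk : (j <= k)%N by apply: leq_trans rk; apply: ltnW.
    by rewrite -{2}(subnK jk) exprD -mulrA -exprMn mulfV// expr1n mulr1.
have [P PE] := choice powL.
have L0 : (0 < L)%N.
  rewrite addn_gt0 [X in _ || X]size_poly_gt0; apply/orP; right.
  by apply: contra_eq_neq q1 => ->; rewrite horner0 oner_neq0.
apply: (@nakayama V (prodset E V) L (\matrix_(k, l) (P l)`_k) (\row_k x ^+ k)) => //.
- by move=> y z; apply: prodset_scaler.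
- by move=> k l; rewrite mxE; have [] := PE l.
- apply/eqP => /rowP/(_ (Ordinal L0)); rewrite !mxE expr0 => /eqP.
  by rewrite oner_eq0.
- apply/rowP => l; rewrite !mxE; have [_ sP <-] := PE l.
  by rewrite (horner_coef_wide x sP); apply: eq_bigr => k _; rewrite !mxE mulrC.
Qed.

(** Chevalley's extension theorem: an overring [V] maximal among those such that
    [1] is not in MV is a valuation ring, because adjoining [x] or its inverse
    cannot preserve that condition unless the adjoined element was already
    there. *)
Lemma valuation_overring_center M : maximal_ideal M ->
  exists2 V, valuation_overring V & ~ prodset (@FracField.tofrac D @` M) V 1.
Proof.
move=> maxM; have [idM M1 _] := (maximal_idealP M).1 maxM.
set E := _ @` M; have sE : submodule E by apply: submodule_image.
have EV V : overring V -> E `<=` V.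
  by case/overringP=> bV _ _ _ [m _ <-]; apply: bV; apply: base_tofrac.
pose good V := V = set0 \/ (overring V /\ ~ prodset E V 1).
have [C Cgood Ctot|V [gV maxV]] := @Zorn_bigcup K good.
  have [[W [CW Wne]]|allnil] := pselect (exists W, C W /\ W <> set0); last first.
    left; rewrite -subset0 => x [W CW Wx]; apply: allnil; exists W.
    by split=> // W0; rewrite W0 in Wx.
  have mem X x : C X -> X x -> overring X /\ ~ prodset E X 1.
    by move=> CX Xx; case: (Cgood X CX) => // X0; rewrite X0 in Xx.
  have [w Ww] : exists x, W x by apply/set0P/eqP.
  have [/overringP[bW _ _] _] := mem _ _ CW Ww.
  have both x y : (\bigcup_(X in C) X) x -> (\bigcup_(X in C) X) y ->
      exists X, [/\ C X, overring X, X x & X y].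
    move=> [X CX Xx] [Y CY Yy].
    have [oX _] := mem _ _ CX Xx; have [oY _] := mem _ _ CY Yy.
    have [XY|YX] := Ctot _ _ CX CY.
      by exists Y; split=> //; apply: XY.
    by exists X; split=> //; apply: YX.
  right; split.
    apply/overringP; split=> [x bx|x y Ux Uy|x y Ux Uy].
    - by exists W => //; apply: bW.
    - have [X [CX /overringP[_ XB _] Xx Xy]] := both x y Ux Uy.
      by exists X => //; apply: XB.
    - have [X [CX /overringP[_ _ XM] Xx Xy]] := both x y Ux Uy.
      by exists X => //; apply: XM.
  have Cne : C !=set0 by exists W.
  move=> /(prodset_bigcup Cne Ctot)[X CX X1].
  have [X0|[]//] := Cgood _ CX.
  have [n [e [f [_ Xf s1]]]] := X1; rewrite X0 in Xf.
  case: n e f Xf s1 => [|n] e f Xf s1; last by case: (Xf ord0).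
  by move: s1; rewrite big_ord0 => /eqP; rewrite oner_eq0.
have gD : good (base D).
  right; split; first by apply/overringP; split=> //; [exact: baseB|exact: baseM].
  move=> /(prodset_sub (G := E)) E1; apply: M1; apply: base_inj; rewrite tofrac1.
  have [E0 ED _] := sE; apply: E1 => // e f Ee bf.
  by rewrite mulrC; apply: submodule_baseM.
have [oV V1] : overring V /\ ~ prodset E V 1.
  case: gV => // V0; case: (maxV (base D)) => //; rewrite V0; split=> //.
  by move=> /(_ _ base0).
have adj x : ~ V x -> prodset E (adjoin V x) 1.
  move=> nVx; apply: contrapT => A1; case: (maxV (adjoin V x)); last first.
    by right; split=> //; apply: adjoin_overring.
  split; first exact: adjoin_sub.
  by move=> /(_ x (adjoin_gen x oV)).
exists V => //; split=> // x x0; apply: contrapT => /not_orP[Vx Vxi].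
by apply: V1; apply: (adjoin_inv oV sE (EV V oV) x0); apply: adj.
Qed.

(** * From coincidence of operations to Prüfer domains *)

Lemma op_v1 E : colon E `<=` base D -> op_v E 1.
Proof. by move=> cE x cx; rewrite mul1r; apply: cE. Qed.

(** An [x] carrying I(D : I) into [D] stabilizes (D : I), so the first hypothesis
    makes the inverse of I(D : I) trivial. Its [v]-closure then contains [1], and
    the second hypothesis removes the closure. *)
Lemma prufer_criterion :
  (forall I, ideal I -> has_nonzero I -> finitely_generated I ->
     forall x, (forall f, colon (@FracField.tofrac D @` I) f ->
                          colon (@FracField.tofrac D @` I) (x * f)) ->
     base D x) ->
  (forall J, ideal J -> has_nonzero J -> op_v (@FracField.tofrac D @` J) 1 ->
     J 1) ->
  prufer D.
Proof.
move=> stab clos I idI [a Ia a0] fgI; set E := _ @` I.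
have sE : submodule E by apply: submodule_image.
have sP := prodset_submodule (colon E) sE.
have Pb : prodset E (colon E) `<=` base D.
  apply: prodset_sub => [||e f Ee cf]; [exact: base0|exact: baseD|].
  by rewrite mulrC; apply: cf.
have Eb : E `<=` base D by move=> _ [b _ <-]; apply: base_tofrac.
have Pa : prodset E (colon E) a%:F.
  rewrite -[_%:F]mulr1; apply: prodset_mul; first by exists a.
  by move=> e Ee; rewrite mul1r; apply: Eb.
have idJ := ideal_preimage sP; set J := [set _ | _] in idJ.
have JE : @FracField.tofrac D @` J = prodset E (colon E).
  rewrite eqEsubset; split=> [_ [d Jd <-] //|x Px].
  by have [d _ dx] := Pb x Px; exists d => //; rewrite /J /= dx.
have J1 : J 1.
  apply: clos => //; first by exists a.
  rewrite JE; apply: op_v1 => x cx; apply: (stab I) => //.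
    by exists a.
  move=> f cf e Ee; rewrite -mulrA [f * e]mulrC; apply: cx.
  exact: prodset_mul.
exists (colon E); first exact: submodule_colon.
rewrite eqEsubset; split=> // x bx; rewrite -[x]mulr1.
by apply: submodule_baseM => //; move: J1; rewrite /J /= tofrac1.
Qed.

Lemma colon_stable_op_v E x : (forall f, colon E f -> colon E (x * f)) ->
  forall e, E e -> op_v E (x * e).
Proof.
move=> xc e Ee f cf; rewrite mulrC mulrA [f * x]mulrC; exact: xc.
Qed.

(** The determinant trick: [x] is an eigenvalue of the matrix expressing the
    products of [x] by the generators of [I] in terms of these generators. *)
Lemma ideal_stable_integral I x : has_nonzero I -> finitely_generated I ->
  (forall e, (@FracField.tofrac D @` I) e -> (@FracField.tofrac D @` I) (x * e)) ->
  integralOver (@FracField.tofrac D) x.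
Proof.
move=> [b Ib b0] [n [a IE]] xI.
have xa (i : 'I_n) : exists c : 'I_n -> D, x * (a i)%:F = (\sum_(j < n) c j * a j)%:F.
  have Ia : I (a i) by rewrite IE; apply: ideal_span_gen.
  have [d Id <-] : (@FracField.tofrac D @` I) (x * (a i)%:F).
    by apply: xI; exists (a i).
  by move: Id; rewrite IE => -[c ->]; exists c.
have [c cE] := choice xa.
pose A : 'M[D]_n := \matrix_(j, i) c i j.
exists (char_poly A); first exact: char_poly_monic.
rewrite map_char_poly -eigenvalue_root_char; apply/eigenvalueP.
exists (\row_i (a i)%:F).
  apply/rowP => i; rewrite !mxE cE rmorph_sum; apply: eq_bigr => j _.
  by rewrite !mxE rmorphM mulrC.
apply: contra_neq b0 => /rowP a0; move: Ib; rewrite IE => -[d ->].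
rewrite big1// => i _; have := a0 i; rewrite !mxE => /eqP.
by rewrite tofrac_eq0 => /eqP->; rewrite mulr0.
Qed.

Lemma integrally_closed_prufer :
  coincide_on_fractional (@op_d D) (@op_v D) -> integrally_closed D -> prufer D.
Proof.
move=> dv icD; apply: prufer_criterion => [I idI nI fgI x xc|J idJ nJ].
  apply/icD/(ideal_stable_integral nI fgI) => e Ee.
  have := dv _ (fractional_image idI nI); rewrite /op_d => ->.
  exact: colon_stable_op_v.
by rewrite -dv; [rewrite -tofrac1 => /base_inj|exact: fractional_image].
Qed.

Lemma op_b_integrally_closed :
  coincide_on_fractional (@op_b D) (@op_v D) -> integrally_closed D.
Proof.
move=> bv x intx; rewrite -op_v_base -bv; last exact: fractional_base.
move=> V vV; rewrite -[x]mul1r; apply: prodset_mul; first exact: base1.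
exact: integral_valuation_overring.
Qed.

Lemma valuation_common_divisor V (s : seq K) : valuation_overring V ->
  (exists2 y, y \in s & y != 0) ->
  exists2 z, z \in s & z != 0 /\ forall y, y \in s -> V (y / z).
Proof.
move=> [oV valV]; have [bV _ VM] := (overringP V).1 oV.
have V1 : V 1 by apply: bV; apply: base1.
have V0 : V 0 by apply: bV; apply: base0.
elim: s => [[]//|y s IHs] nz.
have [nzs|alls] := pselect (exists2 y, y \in s & y != 0); last first.
  have s0 w : w \in s -> w = 0.
    by move=> ws; apply/eqP/negP => /negP w0; apply: alls; exists w.
  have y0 : y != 0.
    by case: nz => w; rewrite in_cons => /orP[/eqP->//|/s0->/eqP].
  exists y; rewrite ?mem_head//; split=> // w; rewrite in_cons => /orP[/eqP->|/s0->].
    by rewrite divff.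
  by rewrite mul0r.
have [z zs [z0 sz]] := IHs nzs; have [y0|y0] := eqVneq y 0.
  exists z; first by rewrite in_cons zs orbT.
  by split=> // w; rewrite in_cons => /orP[/eqP->|/sz//]; rewrite y0 mul0r.
have [Vyz|] := valV (y / z) (mulf_neq0 y0 (invr_neq0 z0)).
  exists z; first by rewrite in_cons zs orbT.
  by split=> // w; rewrite in_cons => /orP[/eqP->|/sz].
rewrite invf_div => Vzy; exists y; rewrite ?mem_head//; split=> // w.
rewrite in_cons => /orP[/eqP->|/sz Vwz]; first by rewrite divff.
by have := VM _ _ Vwz Vzy; rewrite mulrA mulfVK.
Qed.

(** Extended to a valuation overring, a finitely generated ideal becomes
    principal, so it can be cancelled. *)
Lemma op_b_cancel I V x : valuation_overring V ->
  has_nonzero I -> finitely_generated I ->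
  (forall e, (@FracField.tofrac D @` I) e ->
     prodset (@FracField.tofrac D @` I) V (x * e)) -> V x.
Proof.
move=> vV [b Ib b0] [n [a IE]] xI; have [oV _] := vV.
have [V0 VD _] := overring_submodule oV; have [bV _ VM] := (overringP V).1 oV.
have [i0 a0] : exists i, a i != 0.
  apply: contrapT => /forallNP alla; move/eqP: b0; apply.
  move: Ib; rewrite IE => -[c ->]; rewrite big1// => i _.
  by have /negP := alla i; rewrite negbK => /eqP->; rewrite mulr0.
have [|_ /mapP[i _ ->] [z0 zs]] :=
    @valuation_common_divisor V [seq (a i)%:F | i <- enum 'I_n] vV.
  by exists (a i0)%:F; rewrite ?tofrac_eq0//; apply/mapP; exists i0; rewrite ?mem_enum.
have : V (x * (a i)%:F / (a i)%:F); last by rewrite mulfK.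
have Ii : I (a i) by rewrite IE; apply: ideal_span_gen.
have : prodset (@FracField.tofrac D @` I) V (x * (a i)%:F).
  by apply: xI; exists (a i).
apply: (prodset_sub (G := [set y | V (y / (a i)%:F)])) => [|y w Vy Vw|e v Ie Vv] /=.
- by rewrite mul0r.
- by rewrite mulrDl; apply: VD.
- rewrite mulrAC; apply: (VM) => //; case: Ie => d + <-; rewrite IE => -[c ->].
  rewrite rmorph_sum mulr_suml; apply: closed_sum => // j.
  rewrite rmorphM -mulrA; apply: VM; first by apply: bV; apply: base_tofrac.
  by apply: zs; apply/mapP; exists j; rewrite ?mem_enum.
Qed.

Lemma op_b_ideal1 J : ideal J -> op_b (@FracField.tofrac D @` J) 1 -> J 1.
Proof.
move=> idJ b1; apply: contrapT => J1.
have [M maxM JM] := ideal_sub_maximal idJ J1.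
have [V vV M1] := valuation_overring_center maxM; apply: M1.
have [n [e [f [Je Vf s1]]]] := b1 V vV.
by exists n, e, f; split=> // i; have [d /JM Md <-] := Je i; exists d.
Qed.

Lemma op_b_prufer : coincide_on_fractional (@op_b D) (@op_v D) -> prufer D.
Proof.
move=> bv; apply: prufer_criterion => [I idI nI fgI x xc|J idJ nJ].
  rewrite -op_v_base -bv; last exact: fractional_base.
  move=> V vV; rewrite -[x]mul1r; apply: prodset_mul; first exact: base1.
  apply: (op_b_cancel vV nI fgI) => e Ee.
  have : op_b (@FracField.tofrac D @` I) (x * e); last exact.
  by rewrite bv; [exact: colon_stable_op_v|exact: fractional_image].
by rewrite -bv; [exact: op_b_ideal1|exact: fractional_image].
Qed.

(** * Divisorial ideals and h-local domains *)

(** The fractional ideal D_M ∩ a⁻¹D. Bounding denominators by [a] turns the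
    localization into a fractional ideal, so that [v] can be applied to it. *)
Definition bounded_localization M (a : D) : set K :=
  [set z | base D (a%:F * z) /\ localization M z].

Lemma bounded_localization1 M a : maximal_ideal M ->
  bounded_localization M a 1.
Proof.
case/maximal_idealP=> _ M1 _; split; first by rewrite mulr1; apply: base_tofrac.
by exists 1; rewrite // mulr1 tofrac1; apply: base1.
Qed.

Lemma bounded_localization_fractional M a : maximal_ideal M -> a != 0 ->
  fractional_ideal (bounded_localization M a).
Proof.
move=> maxM a0; have [L0 LD LM] := overring_submodule (localization_overring maxM).
split.
- split=> [|x y [ax lx] [ay ly]|b x [ax lx]].
  + by split=> //; rewrite mulr0; apply: base0.
  + by split; [rewrite mulrDr; apply: baseD|apply: LD].
  + split; last exact: LM.
    by rewrite mulrCA; apply: baseM => //; apply: base_tofrac.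
- by exists 1; [exact: bounded_localization1|exact: oner_neq0].
- by exists a => // x [].
Qed.

Lemma colon_bounded_base M a c : maximal_ideal M ->
  colon (bounded_localization M a) c -> base D c.
Proof. by move=> maxM /(_ 1 (bounded_localization1 a maxM)); rewrite mulr1. Qed.

Section Divisorial.
Hypothesis dv : coincide_on_fractional (@op_d D) (@op_v D).

Lemma divisorial E : fractional_ideal E -> op_v E = E.
Proof. by move=> /dv <-. Qed.

Lemma divisorial_image1 I : ideal I -> has_nonzero I ->
  colon (@FracField.tofrac D @` I) `<=` base D -> I 1.
Proof.
move=> idI nI /op_v1; rewrite divisorial; last exact: fractional_image.
by rewrite -tofrac1 => /base_inj.
Qed.

(** The inverse of [N] is contained in D_M ∩ a⁻¹D, because [N] contains [a] and
    elements outside [M]; taking inverses reverses the inclusion. *)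
Lemma colon_bounded_sub M N a c : maximal_ideal M -> maximal_ideal N ->
  M <> N -> a != 0 -> N a -> colon (bounded_localization M a) c ->
  (@FracField.tofrac D @` N) c.
Proof.
move=> maxM maxN MN a0 Na cc; have [idN _ _] := (maximal_idealP N).1 maxN.
have nN : has_nonzero N by exists a.
rewrite -(divisorial (fractional_image idN nN)) => z cz; apply: cc.
split; first by rewrite mulrC; apply: cz; exists a.
have [n Nn Mn] := maximal_neq maxN maxM (nesym MN).
by exists n => //; rewrite mulrC; apply: cz; exists n.
Qed.

(** D is the intersection of the D_M ∩ a⁻¹D over the maximal ideals
    containing [a], the other maximal ideals being taken care of by the
    denominator [a]. *)
Lemma base_bounded_local a z : a != 0 -> base D (a%:F * z) ->
  (forall N, maximal_ideal N -> N a ->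
     forall c, colon (bounded_localization N a) c -> base D (z * c)) ->
  base D z.
Proof.
move=> a0 az loc; apply: submodule_local => [|N maxN]; first exact: base_submodule.
have [Na|] := pselect (N a); last by exists a.
have : op_v (bounded_localization N a) z by apply: loc.
by rewrite divisorial => [[]//|]; apply: bounded_localization_fractional.
Qed.

(** The elements of [D] lying in all but finitely many of the maximal ideals
    that contain [a] form an ideal. By [colon_bounded_sub] it contains the
    inverses of all D_M ∩ a⁻¹D, whence its own inverse is [D]; being
    divisorial, it contains [1]. *)
Lemma divisorial_finite_character I : ideal I -> has_nonzero I ->
  finite_set [set M : set D | maximal_ideal M /\ I `<=` M].
Proof.
move=> idI [a Ia a0].
pose miss (d : D) := [set N : set D | [/\ maximal_ideal N, N a & ~ N d]].
pose C : set D := [set d | finite_set (miss d)].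
suff C1 : C 1.
  apply: sub_finite_set C1 => N [maxN IN]; split=> //; first exact: IN.
  by have [_ N1 _] := (maximal_idealP N).1 maxN.
have idC : ideal C.
  apply/idealP; split=> [|x y Cx Cy|b x].
  - apply: (@sub_finite_set _ _ set0); last exact: finite_set0.
    by move=> N [/maximal_idealP[/idealP[N0 _ _] _ _] _].
  - apply: (@sub_finite_set _ _ (miss x `|` miss y)); last by rewrite finite_setU.
    move=> N [maxN Na Nxy]; have [/idealP[_ ND _] _ _] := (maximal_idealP N).1 maxN.
    have [Nx|Nx] := pselect (N x); last by left.
    by right; split=> // Ny; apply: Nxy; apply: ND.
  - apply: sub_finite_set => N [maxN Na Nbx]; split=> // Nx; apply: Nbx.
    by have [/idealP[_ _ NM] _ _] := (maximal_idealP N).1 maxN; apply: NM.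
have Ca : C a.
  apply: (@sub_finite_set _ _ set0); last exact: finite_set0.
  by move=> N [].
apply: divisorial_image1 => //; first by exists a.
move=> z cz; apply: (base_bounded_local a0) => [|M maxM Ma c cc].
  by rewrite mulrC; apply: cz; exists a.
have [d _ dc] := colon_bounded_base maxM cc.
apply: cz; exists d => //; apply: (@sub_finite_set _ _ [set M]); last exact: finite_set1.
move=> N [maxN Na Nd]; apply: contrapT => NM; apply: Nd; apply: base_inj.
by rewrite dc; apply: (colon_bounded_sub maxM maxN _ a0 Na cc) => MN; apply: NM.
Qed.

(** The inverse of D_N ∩ a⁻¹D lies in [M] for all other [N]. If it did for
    [N = M] too, then by duality the inverse of [M] would lie in all the
    D_N ∩ a⁻¹D, hence in [D]. *)
Lemma divisorial_conductor M a : maximal_ideal M -> a != 0 ->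
  exists2 c, ~ M c & colon (bounded_localization M a) c%:F.
Proof.
move=> maxM a0; have [idM M1 _] := (maximal_idealP M).1 maxM.
have [Ma|] := pselect (M a); last by exists a => // z [].
apply: contrapT => noc; apply: M1; apply: divisorial_image1 => //.
  by exists a.
move=> z cz; apply: (base_bounded_local a0) => [|N maxN Na c cc].
  by rewrite mulrC; apply: cz; exists a.
apply: cz; have [NM|NM] := pselect (N = M); last first.
  exact: (colon_bounded_sub maxN maxM NM a0 Ma cc).
have [d _ dc] := colon_bounded_base maxN cc; exists d => //.
by apply: contrapT => Md; apply: noc; exists d; rewrite // -NM dc.
Qed.

(** Take [a] in [P], and [c] outside [M] with c(D_M ∩ a⁻¹D) ⊆ D; were [N] not
    [M], it would contain [c]. As D_N is a valuation ring, either [a] divides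
    [s * c ^+ 2] for some [s] outside [N], which primality of [P] excludes, or
    [s * a = r * c ^+ 2] for such an [s]. Then [r / a = s / c ^+ 2] is in
    D_M ∩ a⁻¹D, so that [s / c] is in [D] and [s] is in [N] after all. *)
Lemma divisorial_prime_maximal P M N : prufer D -> prime_ideal P ->
  has_nonzero P -> maximal_ideal M -> maximal_ideal N ->
  P `<=` M -> P `<=` N -> M = N.
Proof.
move=> prD [/proper_idealP[idP _] prP] [a Pa a0] maxM maxN PM PN.
apply: contrapT => MN; have [c Mc cc] := divisorial_conductor maxM a0.
have Nc : N c.
  by apply: base_inj; apply: (colon_bounded_sub maxM maxN MN a0 (PN _ Pa) cc).
have [/idealP[M0 _ _] _ _] := (maximal_idealP M).1 maxM.
have [/idealP[_ _ NM] _ _] := (maximal_idealP N).1 maxN.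
have c0 : c != 0 by apply/eqP => c0; apply: Mc; rewrite c0.
have aF0 : a%:F != 0 :> K by rewrite tofrac_eq0.
have cF0 : c%:F != 0 :> K by rewrite tofrac_eq0.
have pP u v : P (u * v) -> P u \/ P v.
  by move=> Puv; have := prP u v; rewrite !in_setE => /(_ Puv)/orP[];
    rewrite in_setE; [left|right].
have [_ /(_ (c%:F * c%:F / a%:F))] := prufer_localization_valuation prD maxN.
rewrite !mulf_neq0 ?invr_neq0// => /(_ isT)[[s Ns [r _ rE]]|[s Ns [r _ rE]]].
  have sc : s * (c * c) = r * a.
    apply/eqP; rewrite -(tofrac_eq (s * (c * c))) !tofracM rE.
    by rewrite -mulrA mulfVK.
  have : P (s * (c * c)).
    by rewrite sc; case/idealP: idP => _ _; apply.
  by case/pP => [/PN//|/pP[|] /PM].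
have rcE : r%:F * (c%:F * c%:F) = s%:F * a%:F.
  by rewrite rE invf_div -mulrA mulfVK ?mulf_neq0.
have sE : r%:F / a%:F * (c%:F * c%:F) = s%:F by rewrite mulrAC rcE mulfK.
have [|d _ dE] := cc (r%:F / a%:F).
  split; first by rewrite mulrC mulfVK//; apply: base_tofrac.
  exists (c * c); first exact: maximal_prime.
  by rewrite tofracM mulrC sE; apply: base_tofrac.
case: Ns; have -> : s = d * c; last exact: NM.
by apply/eqP; rewrite -(tofrac_eq s) tofracM dE [c%:F * _]mulrC -mulrA sE.
Qed.

Lemma divisorial_h_local : prufer D -> h_local D.
Proof.
move=> prD; split=> [|P prP nP]; first exact: divisorial_finite_character.
have [/proper_idealP[idP P1] _] := prP.
have [M maxM PM] := ideal_sub_maximal idP P1.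
exists M; split=> // N [maxN PN]; exact: (divisorial_prime_maximal prD prP).
Qed.

(** A nonzero divisorial maximal ideal has the form (D : (1, x)) for some [x]
    outside [D], so it is the inverse of an invertible fractional ideal. *)
Lemma divisorial_maximal_fg M : prufer D -> maximal_ideal M ->
  finitely_generated M.
Proof.
move=> prD maxM; have [idM M1 topM] := (maximal_idealP M).1 maxM.
have [nM|zM] := pselect (has_nonzero M); last first.
  exists 0%N, (fun=> 0); rewrite eqEsubset; split=> [x Mx|_ [c ->]]; last first.
    by rewrite big_ord0; case/idealP: idM.
  exists (fun=> 0); rewrite big_ord0; apply/eqP/negPn/negP => x0.
  by apply: zM; exists x.
have [x cx bx] : exists2 x, colon (@FracField.tofrac D @` M) x & ~ base D x.
  apply: contrapT => nox; apply: M1; apply: divisorial_image1 => // x cx.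
  by apply: contrapT => bx; apply: nox; exists x.
have ME : [set d : D | base D (d%:F * x)] = M.
  apply: topM => [||d Md /=]; last by rewrite mulrC; apply: cx; exists d.
    by apply: ideal_denominators; apply: base_submodule.
  by rewrite /= tofrac1 mul1r.
have [p [q [q0 xE]]] := fractionP x.
have qF0 : q%:F != 0 :> K by rewrite tofrac_eq0.
have [n [e [f [Ie bf s1]]]] := invertible_dual_basis (prufer_span2 p prD q0).
have pf i : base D (p%:F * f i).
  by apply: bf; exists p => //; exists 1, 0; ring.
have qf i : exists m, m%:F = q%:F * f i.
  have [|m _ mE] := bf i q%:F; last by exists m.
  by exists q => //; exists 0, 1; ring.
(* With x = p / q, M = (D : (1, x)) is q times the inverse of (p, q), and this
   inverse is generated by the [f i]. *)
have [m mE] := choice qf; exists n, m.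
have Mm i : M (m i).
  rewrite -ME /= mE xE; have -> : q%:F * f i * (p%:F / q%:F) = p%:F * f i.
    by rewrite mulrC mulrA mulfVK.
  exact: pf.
rewrite eqEsubset; split=> [d Md|_ [c ->]]; last first.
  case/idealP: idM => M0 MD MM; apply: (big_ind M) => // i _; exact: MM.
have dx : base D (d%:F * (p%:F / q%:F)) by move: Md; rewrite -ME /= xE.
have de i : exists b, b%:F = d%:F * e i / q%:F.
  have [_ [u [v ->]] <-] := Ie i; have [b _ bE] := dx.
  exists (u * b + v * d); rewrite !(tofracD, tofracM) bE.
  apply: (mulIf qF0); rewrite mulfVK// mulrDl !mulrA mulfVK//; ring.
have [b bE] := choice de; exists b; apply/eqP.
rewrite -(tofrac_eq d) rmorph_sum -[X in X == _]mulr1 s1 mulr_sumr; apply/eqP.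
by apply: eq_bigr => i _; rewrite rmorphM /= bE mE [RHS]mulrA mulfVK// mulrA.
Qed.

End Divisorial.

(** For all [a] together, this says that [K] is the only ring between D_M and
    [K] that contains D_N. If some [a] violates it, [a] belongs to the set of
    elements of [D] dividing no product [s * t] with [s] outside [M] and [t]
    outside [N]; because D_M is a valuation ring, this set is closed under
    addition, and it is a prime ideal lying under both [M] and [N]. *)
Lemma h_local_independent M N a : h_local D -> prufer D ->
  maximal_ideal M -> maximal_ideal N -> M <> N -> a != 0 ->
  exists s t r, [/\ ~ M s, ~ N t & s * t = r * a].
Proof.
move=> [_ uniqM] prD maxM maxN MN a0; apply: contrapT => noa.
have [idM M1 _] := (maximal_idealP M).1 maxM.
have [idN N1 _] := (maximal_idealP N).1 maxN.
pose P := [set p | forall s t r, ~ M s -> ~ N t -> s * t <> r * p].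
have PM : P `<=` M.
  move=> p Pp; apply: contrapT => Mp; apply: (Pp p 1 1) => //.
  by rewrite mulr1 mul1r.
have PN : P `<=` N.
  move=> p Pp; apply: contrapT => Np; exact: (Pp 1 p 1).
have PX b p : P p -> P (b * p).
  by move=> Pp s t r Ms Nt; rewrite mulrA; apply: Pp.
have P0 : P 0.
  move=> s t r Ms Nt /eqP; rewrite mulr0 mulf_eq0 => /orP[/eqP s0|/eqP t0].
    by apply: Ms; rewrite s0; case/idealP: idM.
  by apply: Nt; rewrite t0; case/idealP: idN.
(* One of [p] and [q] divides the other up to a factor [u] outside [M]. *)
have PDdiv p q u r : P q -> ~ M u -> u * p = r * q -> P (p + q).
  move=> Pq Mu upq s t k Ms Nt st; apply: (Pq (u * s) t (k * (r + u))) => //.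
    exact: maximal_prime.
  by rewrite -mulrA st mulrCA mulrDr upq; ring.
have PD p q : P p -> P q -> P (p + q).
  move=> Pp Pq; have [->|p0] := eqVneq p 0; first by rewrite add0r.
  have [->|q0] := eqVneq q 0; first by rewrite addr0.
  have pF0 : p%:F != 0 :> K by rewrite tofrac_eq0.
  have qF0 : q%:F != 0 :> K by rewrite tofrac_eq0.
  have [_ /(_ (p%:F / q%:F))] := prufer_localization_valuation prD maxM.
  rewrite !mulf_neq0 ?invr_neq0// => /(_ isT)[[u Mu [r _ rE]]|[u Mu [r _ rE]]].
    apply: (PDdiv p q u r) => //; apply/eqP.
    by rewrite -(tofrac_eq (u * p)) !tofracM rE -mulrA mulfVK.
  rewrite addrC; apply: (PDdiv q p u r) => //; apply/eqP.
  by rewrite -(tofrac_eq (u * q)) !tofracM rE invf_div -mulrA mulfVK.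
have prP : prime_ideal P.
  split.
    by apply/proper_idealP; split; [apply/idealP|move=> /PM].
  move=> p q; rewrite !in_setE => Ppq; apply/orP; rewrite !in_setE.
  apply: contrapT => /not_orP[Pp Pq].
  have notP p' : ~ P p' -> exists s t r, [/\ ~ M s, ~ N t & s * t = r * p'].
    apply: contra_notP => nos s t r Ms Nt st.
    by apply: nos; exists s, t, r.
  have [s [t [r [Ms Nt st]]]] := notP p Pp.
  have [s' [t' [r' [Ms' Nt' st']]]] := notP q Pq.
  apply: (Ppq (s * s') (t * t') (r * r')); try exact: maximal_prime.
  by rewrite mulrACA st st' mulrACA.
have Pa : P a by move=> s t r Ms Nt st; apply: noa; exists s, t, r.
have [|L [_ uniqL]] := uniqM P prP; first by exists a.
by apply: MN; rewrite -(uniqL M)// -(uniqL N).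
Qed.

(** The product of the elements given by [h_local_independent], for the finitely
    many [N] other than [M] that contain [a], serves as [c]. *)
Lemma h_local_conductor M a : h_local D -> prufer D -> maximal_ideal M ->
  a != 0 -> exists2 c, ~ M c & colon (bounded_localization M a) c%:F.
Proof.
move=> hl prD maxM a0; have [idM M1 _] := (maximal_idealP M).1 maxM.
have [fin _] := hl.
have [||s sE] := (finite_seqP _).1 (fin (ideal_span (fun _ : 'I_1 => a)) _ _).
- exact: ideal_span_ideal.
- by exists a => //; apply: (ideal_span_gen _ ord0).
have [c Mc cs] : exists2 c, ~ M c & forall N, N \in s -> maximal_ideal N ->
    M <> N -> exists t r, ~ N t /\ c * t = r * a.
  elim: {sE} s => [|N s [c Mc cs]]; first by exists 1.
  have [[maxN MN]|noN] := pselect (maximal_ideal N /\ M <> N); last first.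
    exists c => // L; rewrite in_cons => /orP[/eqP-> maxN MN|]; last exact: cs.
    by case: noN.
  have [u [t [r [Mu Nt ut]]]] := h_local_independent hl prD maxM maxN MN a0.
  exists (c * u); first exact: maximal_prime.
  move=> L; rewrite in_cons => /orP[/eqP-> _ _|Ls maxL ML].
    by exists t, (c * r); split=> //; rewrite -mulrA ut mulrA.
  have [t' [r' [Lt' ct']]] := cs L Ls maxL ML.
  by exists t', (r' * u); split=> //; rewrite mulrAC ct'; ring.
exists c => // z [az [u Mu uz]].
apply: submodule_local => [|N maxN]; first exact: base_submodule.
have [idN N1 _] := (maximal_idealP N).1 maxN.
have [Na|Na] := pselect (N a); last first.
  exists a => //; rewrite mulrCA; apply: baseM => //; exact: base_tofrac.
have [MN|MN] := pselect (M = N).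
  exists u; first by rewrite -MN.
  by rewrite mulrCA; apply: baseM => //; apply: base_tofrac.
have Ns : N \in s.
  suff : [set` s] N by [].
  rewrite -sE; split=> // _ [b ->]; rewrite big_ord1.
  by case/idealP: idN => _ _; apply.
have [t [r [Nt ct]]] := cs N Ns maxN MN; exists t => //.
rewrite mulrA [t%:F * _]mulrC -tofracM ct tofracM -mulrA.
by apply: baseM => //; apply: base_tofrac.
Qed.

(** Suppose [x] is not in [E]; then (E : x) lies in some maximal ideal [M]. This
    [M] is generated at [M] by one element [m], and as D_M is a valuation ring,
    (x m)⁻¹E ⊆ D_M. Some [c] outside [M] carries (x m)⁻¹E into [D], so
    c(x m)⁻¹ is in (D : E); but it sends [x] to [c / m], which is not in [D]. *)
Lemma h_local_divisorial : h_local D -> prufer D ->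
  (forall M : set D, maximal_ideal M -> finitely_generated M) ->
  coincide_on_fractional (@op_d D) (@op_v D).
Proof.
move=> hl prD fgM E [sE [e0 Ee0 e0n] [b b0 bE]].
rewrite /op_d eqEsubset; split=> [|x vx]; first exact: sub_op_v.
apply: contrapT => Ex.
have idA := ideal_denominators x sE.
have [|M maxM AM] := ideal_sub_maximal idA; first by rewrite /= tofrac1 mul1r.
have [idM M1 _] := (maximal_idealP M).1 maxM.
have x0 : x != 0 by apply/eqP => x0; apply: Ex; rewrite x0; case: sE.
(* Numerator and denominator of [x / e0] show that (E : x) is nonzero. *)
have nM : has_nonzero M.
  have [p [q [q0 xE]]] := fractionP (x / e0).
  have qF0 : q%:F != 0 :> K by rewrite tofrac_eq0.
  exists q => //; apply: AM => /=.
  have -> : q%:F * x = p%:F * e0.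
    by rewrite -[x](mulfVK e0n) xE mulrA [q%:F * _]mulrC mulfVK.
  by case: sE => _ _; apply.
have invM := prD M idM nM (fgM M maxM).
have [_ [f [t [[m Mm <-] bf Mt mf]]]] := invertible_locally_principal invM maxM.
have mF0 : m%:F != 0 :> K.
  apply/eqP => m0; apply: Mt; move/eqP: mf; rewrite m0 mul0r eq_sym tofrac_eq0.
  by move=> /eqP->; case/idealP: idM.
have [p [q [q0 xmE]]] := fractionP (x * m%:F).
have qF0 : q%:F != 0 :> K by rewrite tofrac_eq0.
have pF0 : p%:F != 0 :> K.
  apply/eqP => pz; move/eqP: xmE; rewrite pz mul0r mulf_eq0 (negPf x0).
  by rewrite (negPf mF0).
have p0 : p != 0 by rewrite tofrac_eq0 in pF0.
have [c Mc cc] := h_local_conductor hl prD maxM (mulf_neq0 p0 b0).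
have Ey e : E e -> bounded_localization M (p * b) (e / (x * m%:F)).
  move=> Ee; split.
    rewrite xmE tofracM.
    have -> : p%:F * b%:F * (e / (p%:F / q%:F)) = q%:F * (b%:F * e).
      rewrite invf_div; apply: (mulIf pF0); rewrite !mulrA mulfVK//; ring.
    by apply: baseM; [exact: base_tofrac|exact: bE].
  have [->|en0] := eqVneq e 0.
    by rewrite mul0r; exists 1; rewrite ?mulr0 //; apply: base0.
  have [_ /(_ (e / x))] := prufer_localization_valuation prD maxM.
  have noM s r : ~ M s -> s%:F * x = r%:F * e -> False.
    move=> Ms sx; apply: Ms; apply: AM; rewrite /= sx.
    by case: sE => _ _; apply.
  rewrite mulf_neq0 ?invr_neq0// => /(_ isT)[[s Ms [r _ rE]]|[s Ms [r _ rE]]]; last first.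
    by case: (noM s r) => //; rewrite rE invf_div -mulrA mulfVK.
  have Mr : M r.
    apply: contrapT => Mr; case: (noM r s) => //.
    by rewrite rE -mulrA mulfVK.
  exists (t * s); first exact: maximal_prime.
  have -> : (t * s)%:F * (e / (x * m%:F)) = r%:F * f.
    rewrite tofracM -mf rE invfM; move: x^-1 => y.
    by apply: (mulIf mF0); rewrite !mulrA mulfVK//; ring.
  by apply: bf; exists r.
have cy : colon E (c%:F / (x * m%:F)).
  by move=> e /Ey/cc; rewrite mulrAC mulrA.
have [d _ dE] := vx _ cy; apply: Mc.
have -> : c = d * m; last by case/idealP: idM => _ _; apply.
by apply/eqP; rewrite -(tofrac_eq c) tofracM dE mulrAC mulrC mulfVK ?mulf_neq0.
Qed.

End Theory.

Theorem proposition32 (D : idomainType) :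
  (coincide_on_fractional (@op_b D) (@op_v D) <->
     [/\ h_local D, prufer D
       & forall M : set D, maximal_ideal M -> finitely_generated M]) /\
  (coincide_on_fractional (@op_b D) (@op_v D) <->
     coincide_on_fractional (@op_d D) (@op_v D) /\ integrally_closed D).
Proof.
have db (E : set {fraction D}) : prufer D -> fractional_ideal E -> op_b E = op_d E.
  by move=> prD [sE _ _]; apply: prufer_op_b.
have b2d : coincide_on_fractional (@op_b D) (@op_v D) ->
    coincide_on_fractional (@op_d D) (@op_v D).
  by move=> bv E fE; rewrite -db//; [exact: bv|exact: op_b_prufer].
split; split.
- move=> bv; have prD := op_b_prufer bv; have dv := b2d bv.
  by split=> // [|M]; [exact: divisorial_h_local|exact: divisorial_maximal_fg].
- by move=> [hl prD fgM] E fE; rewrite db//; apply: h_local_divisorial.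
- by move=> bv; split; [exact: b2d|exact: op_b_integrally_closed].
- move=> [dv icD] E fE; rewrite db//; first exact: dv.
  exact: integrally_closed_prufer.
Qed.
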